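(* For every integer $k\ge 3$, every positive rational $a/b$ with $b$ squarefree is a finite sum of distinct unit fractions $1/m$, where each $m$ is squarefree with exactly $k$ distinct prime factors. *)

(* Defs.v *)
From mathcomp Require Import all_boot all_order all_algebra.

Set Implicit Arguments.
Unset Strict Implicit.
Unset Printing Implicit Defensive.

(* Since [0 * 0 %| 0], zero is not squarefree; a squarefree number is
   therefore positive. *)
Definition squarefree (n : nat) : Prop :=
  forall d : nat, d * d %| n -> d = 1.

(* Main.v *)
Require Import Defs.
From mathcomp Require Import all_boot all_order all_algebra.
From mathcomp Require Import zify ring lra.
Import Order.TTheory GRing.Theory Num.Theory.
Local Open Scope ring_scope.

Set Implicit Arguments.
Unset Strict Implicit.
Unset Printing Implicit Defensive.

(* Let K = k - 2 and let R be K huge primes not dividing b.  It suffices to write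
   X = a * prod R / b, which is large, as a sum of distinct 1/(p p') with p < p'
   primes outside R, and then to divide by prod R.

   Let P be the product of the primes <= x outside R, and suppose that every N/P
   in [lo, hi] is such a sum, with p' <= x.  If q is the next prime and D a set of
   primes below q such that the subset sums of the 1/p, p in D, are all residues
   mod q, then for every N some subset of the 1/(q p), p in D, can be subtracted
   from N/(q P) so as to clear q from the denominator: the fractions N/(q P) are
   representable in [lo + r, hi] with r = sum over D of 1/(q p).  Adding the
   unused term 1/(2q) extends this to [lo + r, hi + 1/(2q)].  If the 1/p, p in D,
   sum to at most 1/2, the interval does not shrink, and hi tends to infinity
   because the sum of 1/q diverges; hence X is eventually reached, and b divides
   P by then.

   The sets D exist for large q because there are about q / log q primes below q
   (Chebyshev) while O(log q) well chosen residues suffice (Cauchy-Davenport and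
   an averaging argument); for small q they are found by computation.  The first
   interval has P = 2*3*5*7, where terms 1/(p l) with l = 31, 41, 59, 71 combine
   to multiples of 1/210. *)

(** * Sumsets in the prime field *)

Section Sumsets.

Variable q : nat.
Hypothesis q_prime : prime q.
Implicit Types (A B S X : {set 'F_q}) (x y : 'F_q).

Definition sumset A B := [set x + y | x in A, y in B].
Definition shift x A := [set y + x | y in A].

Lemma mem_shift x A y : (y \in shift x A) = (y - x \in A).
Proof.
apply/imsetP/idP => [[z zA ->]|h]; first by rewrite addrK.
by exists (y - x) => //; rewrite subrK.
Qed.

Lemma card_shift x A : #|shift x A| = #|A|.
Proof. by rewrite card_imset //; apply: addIr. Qed.

Lemma sumset_ge A B x : x \in B -> (#|A| <= #|sumset A B|)%N.
Proof.
move=> xB; rewrite -(card_shift x); apply/subset_leq_card/subsetP => y.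
by case/imsetP => z zA ->; apply/imset2P; exists z x.
Qed.

(** A nonzero [x] generates the additive group: [y] is reached from [a] in [(y - a) / x] steps. *)
Lemma shift_closed_full A x a :
  a \in A -> x != 0 -> shift x A \subset A -> A = setT.
Proof.
move=> aA x0 /subsetP sA; apply/setP => y; rewrite inE.
have step k : a + x *+ k \in A.
  elim: k => [|k IH]; first by rewrite mulr0n addr0.
  by apply: sA; rewrite mem_shift mulrSr addrA addrK.
suff -> : y = a + x *+ ((y - a) / x : 'F_q) by apply: step.
by rewrite -mulr_natr natr_Zp mulrC divfK // addrC subrK.
Qed.

(* Dyson's e-transform: (A, B) is replaced by (A ∪ (B + e), B ∩ (A - e)). *)
Lemma cauchy_davenport A B : A != set0 -> B != set0 ->
  (minn q (#|A| + #|B|).-1 <= #|sumset A B|)%N.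
Proof.
move: {2}#|B|.+1 (ltnSn #|B|) => n; elim: n A B => // n IH A B ltBn A0 B0.
have [x xB] := set0Pn _ B0; have [B1|B1] := leqP #|B| 1.
  have -> : #|B| = 1%N by apply/eqP; rewrite eqn_leq B1 card_gt0.
  by rewrite addn1 (leq_trans (geq_minr _ _)) // (sumset_ge _ xB).
have [y yB yx] : exists2 y, y \in B & y != x.
  have /card_gt0P[y] : (0 < #|B :\ x|)%N by rewrite (cardsD1 x) xB in B1.
  by rewrite !inE => /andP[yx yB]; exists y.
have [a aA] := set0Pn _ A0.
have [sA|/subsetPn[z]] := boolP (shift (y - x) A \subset A).
  have AT : A = setT by apply: (shift_closed_full aA) sA; rewrite subr_eq0.
  rewrite (leq_trans (geq_minl _ _)) // (leq_trans _ (sumset_ge _ xB)) //.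
  by rewrite AT cardsT card_Fp.
rewrite mem_shift => zA zNA; pose e := z - y.
pose A' := A :|: shift e B; pose B' := B :&: shift (- e) A.
have xB' : x \in B'.
  by rewrite inE xB mem_shift /e; congr (_ \in A): zA; ring.
have yB' : y \notin B'.
  by rewrite inE yB mem_shift /e opprK addrC subrK.
have cB' : (#|B'| < #|B|)%N.
  apply: proper_card; apply/properP; split; first exact: subsetIl.
  by exists y.
have cAB : (#|A'| + #|B'|)%N = (#|A| + #|B|)%N.
  rewrite -(card_shift e B) -(cardsUI A (shift e B)); congr addn.
  rewrite -(card_shift e B'); congr #|pred_of_set _|; apply/setP => t.
  by rewrite !inE !mem_shift !inE !mem_shift opprK subrK andbC.
have sub : sumset A' B' \subset sumset A B.
  apply/subsetP => u /imset2P[s t + + ->].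
  rewrite !inE !mem_shift => sA' /andP[tB tA]; case/orP: sA' => [sA|sB].
    by apply/imset2P; exists s t.
  by apply/imset2P; exists (t - - e) (s - e) => //; ring.
apply: leq_trans (subset_leq_card sub); rewrite -cAB; apply: IH.
- exact: leq_trans cB' _.
- by apply/set0Pn; exists a; rewrite inE aA.
- by apply/set0Pn; exists x.
Qed.

(** The gain in size when [x] joins a list whose subset sums form [S]. It is even and subadditive in
    [x], so a bound on it over a set passes to sums of elements and their negatives. *)
Definition new x S := #|shift x S :\: S|.

Lemma card_shiftU x S : #|S :|: shift x S| = (#|S| + new x S)%N.
Proof.
have <- : S :|: (shift x S :\: S) = S :|: shift x S.
  by apply/setP => y; rewrite !inE; case: (y \in S).
rewrite /new cardsU (_ : S :&: _ = set0) ?cards0 ?subn0 //.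
by apply/setP => y; rewrite !inE; case: (y \in S).
Qed.

Lemma card_meet_new x S : (#|S :&: shift x S| + new x S)%N = #|S|.
Proof. by rewrite setIC cardsID card_shift. Qed.

Lemma new0 S : new 0 S = 0%N.
Proof.
by apply/eqP; rewrite cards_eq0 setD_eq0; apply/subsetP => y; rewrite mem_shift subr0.
Qed.

Lemma newN x S : new (- x) S = new x S.
Proof.
have := card_meet_new x S; rewrite -(card_meet_new (- x) S).
suff -> : #|S :&: shift x S| = #|S :&: shift (- x) S| by move/addnI.
rewrite -(card_shift (- x)); congr #|pred_of_set _|; apply/setP => y.
by rewrite !inE !mem_shift !inE !mem_shift opprK addrK andbC.
Qed.

Lemma newD x y S : (new (x + y)%R S <= new x S + new y S)%N.
Proof.
rewrite -[new x S](card_shift y) -cardsUI (leq_trans _ (leq_addr _ _)) //.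
apply/subset_leq_card/subsetP => t; rewrite !inE !mem_shift !inE !mem_shift.
rewrite (_ : t - y - x = t - (x + y)); last by ring.
by case: (t - y \in S); case: (t \in S); case: (_ \in S).
Qed.

(** Double counting: a pair of elements [s] and [s - x] of [S] determines [x], so each of the
    [#|S| * #|S|] pairs is counted at most once. *)
Lemma sum_card_meet X S : (\sum_(x in X) #|S :&: shift x S| <= #|S| * #|S|)%N.
Proof.
have e x : #|S :&: shift x S| = (\sum_(s in S) (s - x \in S)%R)%N.
  rewrite -sum1_card [RHS]big_mkcond /= big_mkcond /=.
  by apply: eq_bigr => s _; rewrite inE mem_shift; do 2!case: (_ \in S).
rewrite (eq_bigr _ (fun x _ => e x)) exchange_big /= -sum_nat_const leq_sum // => s _.
rewrite -(card_imset (mem S) (can_inj (subKr s))) -sum1_card.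
rewrite big_mkcond [leqRHS]big_mkcond leq_sum //= => x _.
case: (x \in X) => //; have [h|//] := boolP (s - x \in S).
by rewrite ifT //; apply/imsetP; exists (s - x) => //; rewrite subKr.
Qed.

Fixpoint nsum A (j : nat) : {set 'F_q} :=
  if j is j'.+1 then sumset (nsum A j') A else [set 0].

Lemma card_nsum A (n j : nat) :
  (2 * n < #|A|)%N -> (minn q (2 * n * j).+1 <= #|nsum A j|)%N.
Proof.
move=> hA; have A0 : A != set0 by rewrite -card_gt0; lia.
elim: j => [|j IH] /=; first by rewrite muln0 cards1 geq_minr.
have q0 := prime_gt0 q_prime.
have N0 : nsum A j != set0 by rewrite -card_gt0; lia.
have := cauchy_davenport N0 A0; move: IH hA; rewrite (mulnS (2 * n)).
move: #|sumset _ _| #|nsum A j| #|A| (2 * n * j)%N (2 * n)%N => c w a u v; lia.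
Qed.

Definition symm A := 0 |: (A :|: [set - x | x in A]).

Lemma new_nsum S A (g j : nat) x :
  (forall a, a \in A -> (new a S <= g)%N) -> x \in nsum (symm A) j ->
  (new x S <= j * g)%N.
Proof.
move=> hg; elim: j x => [|j IH] x /=; first by rewrite inE => /eqP->; rewrite new0.
case/imset2P => y z /IH hy hz ->; rewrite (leq_trans (newD _ _ _)) // mulSn addnC leq_add //.
move: hz; rewrite !inE => /or3P[/eqP->|/hg//|/imsetP[a /hg ha ->]]; first by rewrite new0.
by rewrite newN.
Qed.

(* Averaging over the j-fold sumset of A ∪ -A ∪ {0}, which has at least 2|S|
   elements: some x moves half of S out of S, and x is a sum of j elements. *)
Lemma new_ge S A (n : nat) : (0 < n)%N -> (2 * n < #|symm A|)%N -> (0 < #|S|)%N ->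
  (2 * #|S| <= q)%N ->
  exists2 a, a \in A & (minn (2 * #|S|) n <= 4 * new a S)%N.
Proof.
move=> n0 hA S0 hS; apply/exists_inP; rewrite -[X in is_true X]negbK negb_exists_in.
apply/negP => /forall_inP h.
pose g := \max_(a in A) new a S.
have [a aA|A0] := pickP [in A]; last first.
  move: hA; rewrite /symm (_ : A = set0) ?imset0 ?setU0 ?cards1; first lia.
  by apply/setP => x; rewrite inE; apply: A0.
have hg b : b \in A -> (new b S <= g)%N by move=> bA; apply: leq_bigmax_cond.
have g4 : (4 * g < minn (2 * #|S|) n)%N.
  have [|b bA e] := @eq_bigmax_cond _ (mem A) (new^~ S); first by apply/card_gt0P; exists a.
  by rewrite [g]e ltnNge h.
(* [j] is [#|S| / n] rounded up: the [j]-fold sumset then has at least [2 * #|S|] elements, while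
   [j * n < 2 * #|S|] unless [j = 1]. *)
pose j := if (#|S| <= n)%N then 1%N else ((#|S| + n.-1) %/ n)%N.
have hj : (#|S| <= j * n)%N /\ (j = 1%N /\ (#|S| <= n)%N \/ (j * n < 2 * #|S|)%N /\ (n < #|S|)%N).
  rewrite /j; have [hSn|hSn] := leqP #|S| n; first by rewrite mul1n; split => //; left.
  have := divn_eq (#|S| + n.-1) n; have := ltn_pmod (#|S| + n.-1) n0.
  by move: (_ %/ _)%N (_ %% _)%N => u v h1 h2; split; last right; lia.
pose X := nsum (symm A) j.
have cX : (2 * #|S| <= #|X|)%N.
  by have := card_nsum j hA; rewrite -/X; nia.
(* Every [x] in [X] gains at most [j * g], and what is not gained is met. As [#|X|] is at least
   [2 * #|S|], the meets average at most half of [#|S|], so [j * g] is at least the other half. *)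
have key : (#|S| * #|X| <= #|X| * (j * g) + #|S| * #|S|)%N.
  apply: leq_trans (leq_add _ (sum_card_meet X S)); last first.
    rewrite -sum_nat_const; apply: leq_sum => x xX; exact: (new_nsum hg xX).
  rewrite -big_split /= mulnC -sum_nat_const; apply: leq_sum => x _.
  by rewrite addnC card_meet_new.
have : (#|S| <= 2 * (j * g))%N by nia.
by case: hj => _ [[-> ?]|[]]; nia.
Qed.

End Sumsets.

(** * Subset sums *)

(** The size guaranteed by [new_ge] after one more summand; the [+ 3] rounds the quarter up. *)
Definition grow (n s : nat) : nat := (s + (minn (2 * s) n + 3) %/ 4)%N.

Lemma grow_mono n s t : (s <= t)%N -> (grow n s <= grow n t)%N.
Proof. by move=> h; rewrite /grow leq_add // leq_div2r //; lia. Qed.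

Section SubsetSums.

Variable q : nat.
Hypothesis q_prime : prime q.
Implicit Types (D : seq 'F_q) (A : {set 'F_q}) (x y : 'F_q).

Definition ssums D : {set 'F_q} := foldr (fun a S => S :|: shift a S) [set 0] D.

Lemma mem_ssums D x : x \in ssums D -> exists m : bitseq, x = \sum_(a <- mask m D) a.
Proof.
elim: D x => [|a D IH] x /=; first by rewrite inE => /eqP->; exists [::]; rewrite big_nil.
rewrite inE mem_shift => /orP[/IH[m ->]|/IH[m e]].
  by exists (false :: m).
by exists (true :: m); rewrite /= big_cons -e addrC subrK.
Qed.

Lemma ssums_cat D1 D2 x y :
  x \in ssums D1 -> y \in ssums D2 -> x + y \in ssums (D1 ++ D2).
Proof.
elim: D1 x => [|a D1 IH] x /=; first by rewrite inE => /eqP->; rewrite add0r.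
rewrite !inE !mem_shift => /orP[/IH h /h -> //|/IH h /h {}h].
by rewrite (_ : x + y - a = x - a + y) ?h ?orbT //; ring.
Qed.

(** The hypothesis also excludes 0 from [A], since 0 is its own negative; so 0, [A] and [- A] are
    disjoint. *)
Lemma card_symm A : {in A, forall a, - a \notin A} -> #|symm A| = (2 * #|A|).+1.
Proof.
move=> hA; have A0 : 0 \notin A.
  by apply/negP => h; have := hA _ h; rewrite oppr0 h.
rewrite /symm cardsU1 cardsU (_ : A :&: _ = set0) ?cards0; last first.
  apply/setP => x; rewrite !inE; apply/negP => /andP[xA /imsetP[y /hA + e]].
  by rewrite -e xA.
rewrite card_imset; last exact: oppr_inj.
rewrite !inE (negPf A0) /= (_ : (0 \in _) = false) //=; first by rewrite subn0 mul2n addnn.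
by apply/imsetP => -[y yA /eqP]; rewrite eq_sym oppr_eq0 => /eqP e; rewrite e (negPf A0) in yA.
Qed.

Lemma card_setD_seq A D : (#|A| <= size D + #|A :\: [set x in D]|)%N.
Proof.
rewrite -(cardsID [set x in D] A) leq_add2r.
rewrite (leq_trans _ (card_size D)) //; apply/subset_leq_card/subsetP => x.
by rewrite !inE => /andP[].
Qed.

Lemma ssums_grow A (n T : nat) : (0 < n)%N -> {in A, forall a, - a \notin A} ->
  (n + T <= #|A|)%N ->
  exists D, [/\ uniq D, (size D <= T)%N, {subset D <= A} &
    (q < 2 * #|ssums D|)%N || (iter T (grow n) 1 <= #|ssums D|)%N].
Proof.
move=> n0 hA; elim: T => [|T IH] cA.
  by exists [::]; split => //=; rewrite cards1 orbT.
case: IH => [|D [uD sD DA]]; first lia.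
case/boolP: (q < _)%N => [h _|]; first by exists D; rewrite h; split => //; lia.
rewrite -leqNgt => /= hq hit.
pose A' := A :\: [set x in D].
have cA' : (n + 1 <= #|A'|)%N by have := card_setD_seq A D; rewrite -/A'; lia.
have [||||a] := @new_ge q q_prime (ssums D) A' n => //.
- rewrite card_symm; first lia.
  by move=> a; rewrite !inE => /andP[_ /hA /negPf ->]; rewrite andbF.
- by apply: leq_trans hit; elim: (T) => //= t h; apply: leq_trans h (leq_addr _ _).
rewrite !inE => /andP[aD aA] hnew; exists (a :: D); split => //=.
- by rewrite aD.
- by move=> x; rewrite inE => /predU1P[->|/DA].
rewrite card_shiftU; apply/orP; right.
apply: leq_trans (grow_mono n hit) _; rewrite /grow leq_add2l.
apply: leq_trans (leq_div2r 4 (leq_add hnew (leqnn 3))) _; lia.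
Qed.

(* Two disjoint lists with more than q/2 subset sums each: by counting, every x
   is a sum of one subset sum of either. *)
Lemma ssums_full A (n T : nat) : (0 < n)%N -> {in A, forall a, - a \notin A} ->
  (n + 2 * T <= #|A|)%N -> (q < 2 * iter T (grow n) 1)%N ->
  exists D, [/\ uniq D, (size D <= 2 * T)%N, {subset D <= A} & ssums D = setT].
Proof.
move=> n0 hA cA hT.
case: (@ssums_grow A n T) => // [|D1 [u1 s1 A1 h1]]; first lia.
case: (@ssums_grow (A :\: [set x in D1]) n T) => // [|| D2 [u2 s2 A2 h2]].
- by move=> a; rewrite !inE => /andP[_ /hA /negPf ->]; rewrite andbF.
- by have := card_setD_seq A D1; lia.
exists (D1 ++ D2); split.
- rewrite cat_uniq u1 u2 andbT -all_predC; apply/allP => x /A2.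
  by rewrite !inE => /andP[].
- by rewrite size_cat; lia.
- by move=> x; rewrite mem_cat => /orP[/A1|/A2] //; rewrite !inE => /andP[].
apply/setP => x; rewrite inE.
pose B := [set x - y | y in ssums D2].
have cB : #|B| = #|ssums D2| by rewrite card_imset //; apply: can_inj (subKr x).
have half D : (q < 2 * #|ssums D|)%N || (iter T (grow n) 1 <= #|ssums D|)%N ->
    (q < 2 * #|ssums D|)%N.
  by case/orP => // h; rewrite (leq_trans hT) // leq_pmul2l.
have : (0 < #|ssums D1 :&: B|)%N.
  have := cardsUI (ssums D1) B; rewrite cB.
  have := max_card [in ssums D1 :|: B]; rewrite card_Fp //.
  move: (half _ h1) (half _ h2); rewrite -[X in (X <= q)%N]/#|ssums D1 :|: B|.
  move: #|ssums D1 :|: B| #|ssums D1 :&: B| #|ssums D1| #|ssums D2| => u v w t; lia.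
case/card_gt0P => y; rewrite inE => /andP[y1 /imsetP[z z2 e]].
by rewrite (_ : x = y + z) ?ssums_cat // e subrK.
Qed.

End SubsetSums.

(** * Chebyshev's lower bound *)

Definition primes_upto (n : nat) : seq nat := [seq p <- iota 0 n.+1 | prime p].

Lemma mem_primes_upto n p : (p \in primes_upto n) = prime p && (p <= n)%N.
Proof. by rewrite mem_filter mem_iota /= add0n ltnS. Qed.

Lemma primes_upto_uniq n : uniq (primes_upto n).
Proof. by rewrite filter_uniq ?iota_uniq. Qed.

Section Chebyshev.
Local Open Scope nat_scope.

(** Consecutive central coefficients have ratio 2(2h + 1)/(h + 1), so [2 * h * 'C(2 * h, h)] grows
    at least fourfold at each step. *)
Lemma central_bin_ge h : 0 < h -> 2 ^ (2 * h) <= 2 * h * 'C(2 * h, h).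
Proof.
elim: h => // -[|h] IH _; first by rewrite !muln1 bin1.
move: IH => /(_ isT); set H := h.+1 => IH.
have e1 := mul_bin_diag (2 * H).+1 H; have e2 := mul_bin_diag (2 * H).+2 H.
have e3 : 'C((2 * H).+1, H) = 'C((2 * H).+1, H.+1).
  by rewrite -[RHS]bin_sub; [congr 'C(_, _); lia | lia].
have -> : 2 * H.+1 = (2 * H).+2 by lia.
rewrite 2!expnS; move: IH e1 e2 e3; rewrite /=.
move: (2 ^ _) 'C((2 * H).+2, _) 'C((2 * H).+1, H.+1) 'C((2 * H).+1, H) 'C(2 * H, H).
by move=> e u v w t; nia.
Qed.

(** By Legendre's formula the exponent is the sum over k of [(2 * h) %/ p ^ k - 2 * (h %/ p ^ k)].
    Each summand is at most 1, and it vanishes once [p ^ k] exceeds [2 * h]. *)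
Lemma logn_central_bin p h : prime p -> 0 < h -> p ^ logn p 'C(2 * h, h) <= 2 * h.
Proof.
move=> pp h0; have p1 := prime_gt1 pp.
have C0 : 0 < 'C(2 * h, h) by rewrite bin_gt0; lia.
have hl : logn p 'C(2 * h, h) <= trunc_log p (2 * h).
  have := bin_fact (_ : h <= 2 * h); rewrite (_ : 2 * h - h = h); last lia.
  move=> /(_ (leq_pmull h (ltn0Sn 1))) /(congr1 (logn p)).
  rewrite !lognM ?muln_gt0 ?fact_gt0 // !logn_fact // => e.
  have e2 : \sum_(1 <= k < (2 * h).+1) h %/ p ^ k = \sum_(1 <= k < h.+1) h %/ p ^ k.
    rewrite (@big_cat_nat _ _ _ h.+1) //=; last lia.
    rewrite [X in _ + X]big_nat [X in _ + X]big1 ?addn0 // => k /andP[hk _]; apply: divn_small.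
    exact: leq_trans hk (ltnW (ltn_expl k p1)).
  set t := trunc_log p (2 * h); have t2 : t < (2 * h).+1.
    by apply: leq_trans (ltn_expl t p1) _; apply: leqW; apply: trunc_logP => //; lia.
  have e3 : \sum_(1 <= k < (2 * h).+1) (2 * h) %/ p ^ k <=
      \sum_(1 <= k < (2 * h).+1) (2 * (h %/ p ^ k) + (k <= t)).
    rewrite big_nat [leqRHS]big_nat; apply: leq_sum => k /andP[k0 _].
    have pk0 : 0 < p ^ k by rewrite expn_gt0 prime_gt0.
    have [kt|tk] := leqP k t.
      rewrite addn1 -ltnS ltn_divLR //; have := divn_eq h (p ^ k); have := ltn_pmod h pk0.
      by move: (h %/ p ^ k) (h %% p ^ k) (p ^ k) pk0 => u v w w0; nia.
    by rewrite divn_small // (leq_trans (trunc_log_ltn _ p1)) // leq_pexp2l // prime_gt0.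
  move: e3; rewrite -e big_split /= -big_distrr /= e2.
  have -> : \sum_(1 <= k < (2 * h).+1) (k <= t : nat) = t.
    rewrite (@big_cat_nat _ _ _ t.+1) //= [X in _ + X]big_nat_cond [X in _ + X]big1 ?addn0.
      rewrite big_nat_cond (eq_bigr (fun=> 1)) -?big_nat_cond ?sum_nat_const_nat ?muln1 ?subn1 //.
      by move=> k /andP[/andP[_ h1] _]; rewrite -ltnS h1.
    by move=> k /andP[/andP[h1 _] _]; rewrite leqNgt h1.
  lia.
apply: leq_trans (trunc_logP p1 _); last lia.
by rewrite leq_exp2l.
Qed.

(** The coefficient is a product of prime powers, each at most [2 * h], over distinct primes up to
    [2 * h]. *)
Lemma central_bin_le h : 0 < h -> 'C(2 * h, h) <= (2 * h) ^ size (primes_upto (2 * h)).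
Proof.
move=> h0; have C0 : 0 < 'C(2 * h, h) by rewrite bin_gt0; lia.
rewrite [leqLHS](prod_prime_decomp C0) prime_decompE big_map /=.
apply: (@leq_trans (\prod_(p <- primes 'C(2 * h, h)) (2 * h))).
  rewrite big_seq [leqRHS]big_seq leq_prod // => p.
  by rewrite mem_primes => /and3P[pp _ _]; exact: logn_central_bin.
rewrite big_const_seq count_predT iter_muln_1 leq_pexp2l //; first lia.
apply: uniq_leq_size (primes_uniq _) _ => p.
rewrite mem_primes_upto => pC; have:= pC; rewrite mem_primes => /andP[pp _]; rewrite pp /=.
apply: leq_trans (logn_central_bin pp h0); rewrite -[leqLHS]expn1 leq_pexp2l ?(prime_gt0 pp) //.
by rewrite logn_gt0.
Qed.

Lemma chebyshev h : 0 < h -> 2 ^ (2 * h) <= (2 * h) ^ (size (primes_upto (2 * h))).+1.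
Proof.
move=> h0; apply: leq_trans (central_bin_ge h0) _.
by rewrite expnS leq_mul2l central_bin_le ?orbT.
Qed.

End Chebyshev.

(** * Sets of primes whose inverses generate all residues *)

Definition recip (p : nat) : rat := p%:R^-1.

Lemma recip_anti m n : (0 < m)%N -> (m <= n)%N -> recip n <= recip m.
Proof.
by move=> m0 mn; rewrite /recip lef_pV2 ?ler_nat // posrE ltr0n // (leq_trans m0).
Qed.

Definition invs q (D : seq nat) : seq 'F_q := [seq p%:R^-1 | p <- D].

(** The bound 1/2 limits the rise of the lower end of the interval to 1/(2q), and [2 < p] keeps the
    term 1/(2q) free for raising the upper end. *)
Definition eliminator (R : seq nat) (q : nat) (D : seq nat) : Prop :=
  [/\ uniq D,
      {in D, forall p, [/\ prime p, (2 < p < q)%N & p \notin R]},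
      \sum_(p <- D) recip p <= 1 / 2
    & ssums (invs q D) = setT].

(** At most [2 * T] primes are chosen, each at least [4 * T], so their reciprocals sum to at most
    1/2. No two inverses are opposite: two candidates with sum divisible by [q] would sum to [q]
    itself, which is odd, while the candidates are odd too. *)
Lemma eliminator_exists R q (n T : nat) (L : seq nat) :
  prime q -> (0 < n)%N -> (0 < T)%N -> uniq L ->
  {in L, forall p, [/\ prime p, (4 * T <= p < q)%N & p \notin R]} ->
  (n + 2 * T <= size L)%N -> (q < 2 * iter T (grow n) 1)%N ->
  exists D, eliminator R q D.
Proof.
move=> qp n0 T0 uL hL sL hq.
pose A : {set 'F_q} := [set x in invs q L].
have valp p : p \in L -> ((p%:R : 'F_q) : nat) = p.
  by move=> /hL[_ /andP[_ h] _]; rewrite val_Fp_nat // modn_small.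
have cA : #|A| = size L.
  rewrite cardsE -(size_map (fun p => p%:R^-1 : 'F_q)); apply/card_uniqP.
  rewrite map_inj_in_uniq // => x y xL yL /invr_inj e.
  by rewrite -(valp x xL) -(valp y yL) e.
have odd_L p : p \in L -> odd p.
  by move=> /hL[pp /andP[h _] _]; have [e|//] := even_prime pp; lia.
have hA : {in A, forall a, - a \notin A}.
  move=> a; rewrite inE => /mapP[x xL ->]; apply/negP; rewrite inE => /mapP[y yL].
  rewrite -invrN => /invr_inj /eqP; rewrite eq_sym -addr_eq0 -natrD => /eqP e.
  have : ((y + x)%:R : 'F_q) = 0%N :> nat by rewrite e.
  rewrite val_Fp_nat // => /eqP /dvdnP[k e2].
  have /hL[xp /andP[_ hx] _] := xL; have /hL[yp /andP[_ hy] _] := yL.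
  have [ox oy] := (odd_L _ xL, odd_L _ yL).
  have k1 : k = 1%N by have := prime_gt0 xp; nia.
  have oq : odd q.
    have [q2|//] := even_prime qp; have := prime_gt1 xp; lia.
  by move: oq; rewrite -[q]mul1n -k1 -e2 oddD ox oy.
have [|D [uD sD DA DT]] := ssums_full qp n0 hA _ hq; first by rewrite cA.
have hD a : a \in D -> exists2 p, p \in L & a = p%:R^-1.
  by move=> /DA; rewrite inE => /mapP[p pL ->]; exists p.
exists [seq (a^-1 : 'F_q) : nat | a <- D]; split.
- by rewrite map_inj_uniq // => x y /val_inj /invr_inj.
- move=> _ /mapP[a /hD[p pL ->] ->]; rewrite invrK valp //.
  by have [pp h pR] := hL p pL; split => //; lia.
- apply: (@le_trans _ _ (\sum_(a <- D) recip (4 * T))).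
    rewrite big_map big_seq [leRHS]big_seq; apply: ler_sum => _ /hD[p pL ->].
    rewrite invrK valp //; have [pp /andP[h _] _] := hL p pL.
    by rewrite /recip lef_pV2 ?ler_nat // posrE ltr0n ?(prime_gt0 pp) ?muln_gt0.
  rewrite big_const_seq count_predT iter_addr_0 -[leLHS]mulr_natl /recip.
  have T0' : 0 < (T%:R : rat) by rewrite ltr0n.
  rewrite ler_pdivrMr ?ltr0n ?muln_gt0 // natrM mulrA.
  have -> : 1 / 2 * 4 * T%:R = (2 * T)%:R :> rat by rewrite natrM; field.
  by rewrite ler_nat.
- rewrite /invs -map_comp -[RHS]DT; congr ssums; rewrite -[RHS]map_id.
  by apply/eq_in_map => a /hD[p pL ->] /=; rewrite invrK valp.
Qed.

(** * Eliminators for all primes from 2^14 on *)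

Section Large.
Local Open Scope nat_scope.

(** While [2 * s < n], a step multiplies [s] by at least 3/2, so two steps more than double it. *)
Lemma iter_grow_doubling n i :
  2 ^ i <= iter (2 * i) (grow n) 1 \/ n <= 2 * iter (2 * i) (grow n) 1.
Proof.
elim: i => [|i IH]; first by left.
rewrite mulnS iterD; move: IH; set s := iter (2 * i) _ _ => IH.
have ge u : u <= grow n u by rewrite leq_addr.
case: (leqP n (2 * s)) => hs.
  by right; rewrite (leq_trans hs) // leq_mul2l (leq_trans (ge s)) // ge.
case: IH => [IH|]; last lia.
rewrite /= expnS; case: (leqP n (2 * grow n s)) => hs'.
  by right; rewrite (leq_trans hs') // leq_mul2l ge.
by left; rewrite {1}/grow; move: hs'; rewrite /grow; lia.
Qed.

(** After [2 * m] steps the size is at least [n / 2], and from then on each step adds at least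
    [n / 4]. *)
Lemma iter_grow_linear n m t :
  n <= 2 ^ m -> (t + 2) * n <= 4 * iter (t + 2 * m) (grow n) 1.
Proof.
move=> nm; elim: t => [|t IH].
  have := iter_grow_doubling n m; rewrite add0n; move: (iter _ _ _) => s [h|h]; last by lia.
  by have := leq_trans nm h; lia.
rewrite addSn iterS /grow; move: (iter _ _ _) IH => s IH.
have : n <= 2 * s by nia.
lia.
Qed.

Lemma size_primes_upto_odd k : 0 < k -> size (primes_upto (2 * k).+1) <= k.+1.
Proof.
have step n : size (primes_upto n.+1) = size (primes_upto n) + prime n.+1.
  rewrite /primes_upto -addn1 iotaD filter_cat size_cat /= add0n.
  by case: (prime _).
elim: k => // -[|k] IH _; first by [].
have -> : (2 * k.+2).+1 = (2 * k.+1).+3 by lia.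
rewrite 2!step (_ : prime (2 * k.+1).+2 = false).
  by rewrite addn0; apply: leq_trans (leq_add (IH isT) (leq_b1 _)) _; rewrite addn1.
apply/negP; rewrite (_ : (2 * k.+1).+2 = 2 * k.+2); last lia.
by move=> /even_prime[|]; [lia | rewrite oddM].
Qed.

(** This is the source of the threshold 2^14: the inequality fails at [m = 13]. With [T = 6 * m + 8]
    the last factor is [4 * T + m + 2], which covers the discarded primes and the [2 * T] spare
    candidates. *)
Lemma exp_ge_quad m : 14 <= m -> 2 * (m + 1) * (25 * m + 34) <= 2 ^ m.
Proof.
move=> hm; rewrite -(subnK hm); elim: (m - 14) => [//|k IH].
by rewrite addSn expnS; nia.
Qed.

Lemma eliminator_large R q : uniq R -> {in R, forall r, 2 ^ (size R + 14) <= r} ->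
  prime q -> 2 ^ 14 <= q -> exists D, eliminator R q D.
Proof.
move=> uR hR qp q14; pose m := trunc_log 2 q.
have q0 := prime_gt0 qp.
have /andP[mq qm] := @trunc_log_bounds 2 q isT q0; rewrite -/m in mq qm.
have m14 : 14 <= m by apply: trunc_log_max.
have quad := exp_ge_quad m14.
(* [n] is half of Chebyshev's bound [q / (m + 1)] for the number of primes. Of the [T] steps,
   [2 * m] serve the doubling phase; the other [4 * m + 8] add [n / 4] each and so pass [q / 2]. *)
pose n := q %/ (2 * (m + 1)); pose T := 6 * m + 8.
have nq : 2 * (m + 1) * n <= q < 2 * (m + 1) * n + 2 * (m + 1).
  have := divn_eq q (2 * (m + 1)); have : 0 < 2 * (m + 1) by lia.
  by move/(ltn_pmod q); rewrite -/n; lia.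
pose L := [seq p <- primes_upto q.-1 | (4 * T <= p) && (p \notin R)].
have oq : odd q.
  by have [e|//] := even_prime qp; move: q14; rewrite e.
have count_pi : q <= (m + 1) * (size (primes_upto q.-1)).+1 + 1.
  have [h e] : exists h, q.-1 = 2 * h by exists q./2; have := odd_double_half q; rewrite oq; lia.
  have h0 : 0 < h by lia.
  have := chebyshev h0; rewrite -e => hc.
  have : 2 ^ q.-1 <= 2 ^ (m.+1 * (size (primes_upto q.-1)).+1).
    by apply: leq_trans hc _; rewrite expnM leq_exp2r //; lia.
  by rewrite leq_exp2l //; lia.
(* If some member of [R] is below [q], the lower bound on [R] forces [size R + 14 <= m]; otherwise
   [R] removes no candidate. *)
have sizeR : size [seq r <- R | r < q] <= m.
  have [/hasP[r rR rq]|/hasPn h] := boolP (has (fun r => r < q) R).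
    apply: leq_trans (_ : size R <= _); first by rewrite size_filter count_size.
    have : 2 ^ (size R + 14) < 2 ^ m.+1.
      by apply: leq_ltn_trans (hR r rR) _; apply: ltn_trans rq _.
    by rewrite ltn_exp2l //; lia.
  by rewrite (eq_in_filter (a2 := pred0)) ?filter_pred0 // => r /h /negPf.
have sizeP : size (primes_upto (4 * T).-1) <= 2 * T.
  have := @size_primes_upto_odd (2 * T).-1; rewrite (_ : (2 * (2 * T).-1).+1 = (4 * T).-1).
    by rewrite /T; lia.
  by rewrite /T; lia.
have sizeL : size (primes_upto q.-1) <= size L + (2 * T + m).
  apply: (@leq_trans (size (L ++ primes_upto (4 * T).-1 ++ [seq r <- R | r < q]))).
    apply: uniq_leq_size; first exact: primes_upto_uniq.
    move=> p; rewrite mem_primes_upto => /andP[pp pq].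
    rewrite !mem_cat /L [p \in [seq r <- R | _]]mem_filter mem_filter.
    rewrite !mem_primes_upto pp pq /= andbT.
    have -> : p < q by rewrite -(prednK q0) ltnS.
    by case: (p \in R); rewrite ?orbT // andbT !orbF; lia.
  by rewrite !size_cat leq_add2l leq_add.
apply: (@eliminator_exists R q n T L) => //.
- by nia.
- by rewrite /T; lia.
- by rewrite /L filter_uniq // primes_upto_uniq.
- move=> p; rewrite /L mem_filter mem_primes_upto => /andP[/andP[h pR] /andP[pp pq]].
  by split => //; lia.
- by rewrite -/T; move: count_pi sizeL nq quad mq; rewrite /T; nia.
- have nm : n <= 2 ^ m by move: qm; rewrite expnS; nia.
  have := iter_grow_linear (4 * m + 8) nm.
  by rewrite (_ : 4 * m + 8 + 2 * m = T); [nia | rewrite /T; lia].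
Qed.

End Large.

(** * Eliminators below 2^14 by computation *)

Section Small.
Local Open Scope nat_scope.

(* A set of residues mod q is encoded by its indicator sequence, of length q. *)
Definition rot_or (a : nat) (s : bitseq) : bitseq :=
  [seq u.1 || u.2 | u <- zip s (rotr a s)].

Definition inv_mod (q p : nat) : nat := (egcdn p q).1 %% q.

(* Moves candidates from [c] to [D] until the subset sums of the inverses of
   [D], encoded by [bits], are all residues mod [q]. *)
Fixpoint cover_search q (c : seq nat) (bits : bitseq) (D : seq nat) : option (seq nat) :=
  if all id bits then Some D else
  if c is p :: c' then cover_search q c' (rot_or (inv_mod q p) bits) (p :: D)
  else None.

(** Members of at least [2 * size D] have reciprocals summing to at most 1/2; the 3 excludes the
    prime 2. *)
Definition coverable (q : nat) (c : seq nat) : bool :=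
  if cover_search q c (true :: nseq q.-1 false) [::] is Some D
  then all (leq (maxn 3 (2 * size D))) D else false.

(** [prev] holds the smaller primes in descending order, so the search tries the largest first.
    Primes up to 71 belong to the first interval and are skipped. *)
Fixpoint all_coverable (prev L : seq nat) : bool :=
  if L is q :: L' then ((q <= 71) || coverable q prev) && all_coverable (q :: prev) L'
  else true.

(** One implication suffices, since the encoding is only read off when every bit is set. *)
Definition encodes (q : nat) (bits : bitseq) (S : {set 'F_q}) : Prop :=
  size bits = q /\ forall i, i < q -> nth false bits i -> (i%:R)%R \in S.

Lemma inv_modP q p : prime q -> 0 < p < q ->
  inv_mod q p < q /\ ((inv_mod q p)%:R = p%:R^-1 :> 'F_q)%R.
Proof.
move=> qp /andP[p0 pq]; split; first by rewrite ltn_pmod ?prime_gt0.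
have pu : (p%:R != 0 :> 'F_q)%R.
  by rewrite -(dvdn_pcharf (pchar_Fp qp)) gtnNdvd.
apply: (mulIf pu); rewrite mulVf // -natrM.
rewrite -[RHS]/(1%:R)%R; apply/val_inj; rewrite /= !val_Fp_nat //.
have e1 : gcdn p q = 1.
  by apply/eqP; rewrite gcdnC -/(coprime q p) prime_coprime // gtnNdvd.
rewrite /inv_mod modnMml; case: (egcdnP q p0) => u v e _.
by rewrite /= e e1 modnMDl Fp_cast.
Qed.

Lemma encodes_rot_or q p bits (S : {set 'F_q}) : prime q -> 0 < p < q ->
  encodes bits S -> encodes (rot_or (inv_mod q p) bits) (S :|: shift (p%:R^-1)%R S).
Proof.
move=> qp hp [sz hS]; have [aq ea] := inv_modP qp hp.
move: (inv_mod q p) aq ea => a aq ea.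
have szr : size (rotr a bits) = q by rewrite size_rotr.
split; first by rewrite size_map size_zip szr sz minnn.
move=> i iq; rewrite (nth_map (false, false)) ?size_zip ?szr ?sz ?minnn //.
rewrite nth_zip ?szr //= inE mem_shift -ea => /orP[h|h].
  by rewrite hS.
apply/orP; right; move: h; rewrite /rotr /rot nth_cat size_drop sz subKn; last exact: ltnW.
case: ltnP => ia.
  rewrite nth_drop => /(hS _ _) h.
  rewrite (_ : i%:R - a%:R = (q - a + i)%:R :> 'F_q)%R ?h //; first lia.
  by rewrite natrD natrB ?(ltnW aq) // pchar_Fp_0 // add0r addrC.
rewrite nth_take; last by lia.
by move/(hS _ _); rewrite natrB //; apply; lia.
Qed.

Lemma encodes_nil q : prime q -> encodes (true :: nseq q.-1 false) (ssums (invs q [::])).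
Proof.
move=> qp; split; first by rewrite /= size_nseq prednK ?prime_gt0.
move=> [|i] iq /=; first by rewrite mulr0n inE.
by rewrite nth_nseq; case: ifP.
Qed.

Lemma encodes_full q bits (S : {set 'F_q}) : prime q ->
  encodes bits S -> all id bits -> S = setT.
Proof.
move=> qp [sz hS] hall; apply/setP => x; rewrite inE.
have xq : x < q by rewrite -[X in _ < X](card_Fp qp) -[#|_|]/#|'I__| card_ord ltn_ord.
by rewrite -(natr_Zp x) hS //; apply: (all_nthP false hall); rewrite sz.
Qed.

Lemma cover_searchP q c bits D E : prime q ->
  encodes bits (ssums (invs q D)) -> uniq (c ++ D) -> {in c, forall p, 0 < p < q} ->
  cover_search q c bits D = Some E ->
  [/\ uniq E, {subset E <= c ++ D} & ssums (invs q E) = setT].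
Proof.
move=> qp; elim: c bits D => [|p c IH] bits D hb uc hc /=; case: ifP => hall.
- by move=> [<-]; split => //; apply: encodes_full hall.
- by [].
- move=> [<-]; split.
  + by move: uc; rewrite cat_uniq => /and3P[].
  + by move=> x xD; rewrite inE mem_cat xD !orbT.
  + exact: encodes_full hall.
have perm : perm_eq (c ++ p :: D) ((p :: c) ++ D).
  by rewrite -cat1s perm_catCA.
move=> /IH[|||uE sE hE].
- by apply: encodes_rot_or => //; rewrite hc ?mem_head.
- by rewrite (perm_uniq perm).
- by move=> x xc; rewrite hc // inE xc orbT.
by split => // x /sE; rewrite (perm_mem perm).
Qed.

Lemma coverableP R q c : prime q -> uniq c ->
  {in c, forall p, [/\ prime p, p < q & p \notin R]} ->
  coverable q c -> exists D, eliminator R q D.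
Proof.
move=> qp uc hc; rewrite /coverable; case e: cover_search => [D|//] /allP hD.
have q0 := prime_gt0 qp; have p0 p : p \in c -> 0 < p < q.
  by move=> /hc[pp -> _]; rewrite prime_gt0.
case: (cover_searchP qp _ _ p0 e) => [||uD sD eD].
- exact: encodes_nil.
- by rewrite cats0.
exists D; split => //.
- move=> p pD; have := sD p pD; rewrite cats0 => /hc[pp pq pR]; split => //.
  by rewrite pq andbT; have := hD p pD; lia.
- case: D {e sD uD eD} hD => [|d D] hD; first by rewrite big_nil divr_ge0.
  set E := d :: D in hD *; have E0 : (0 < (size E)%:R :> rat)%R by rewrite ltr0n.
  apply: (@le_trans _ _ (\sum_(p <- E) recip (2 * size E)%N)%R).
    rewrite big_seq [leRHS]big_seq; apply: ler_sum => p /hD; rewrite geq_max => /andP[h1 h2].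
    rewrite /recip lef_pV2 ?ler_nat ?posrE ?ltr0n ?muln_gt0 //; exact: leq_trans h1.
  rewrite big_const_seq count_predT iter_addr_0 -[leLHS]mulr_natl /recip natrM.
  by rewrite invfM mulrCA mulfV ?gt_eqF // mulr1 mul1r.
Qed.

Lemma all_coverableP (prev L : seq nat) q : all_coverable prev L ->
  uniq prev -> all prime prev -> path.sorted ltn L -> all prime L ->
  {in prev & L, forall x y, x < y} -> q \in L -> 71 < q ->
  exists c, [/\ uniq c, {in c, forall p, prime p && (p < q)} & coverable q c].
Proof.
elim: L prev => // x L IH prev /= /andP[hx hL] up pp xL /andP[px pL] hlt.
rewrite inE => /predU1P[->|qL] q71.
  exists prev; split => //.
    by move=> p hp; rewrite (allP pp) //= hlt // mem_head.
  by case/orP: hx => // h; lia.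
have hxL : {in L, forall y, x < y}.
  by move=> y yL; have /allP := order_path_min ltn_trans xL; apply.
apply: (IH (x :: prev)) => //=.
- by rewrite up andbT; apply/negP => /hlt/(_ (mem_head _ _)); rewrite ltnn.
- by rewrite px.
- exact: path_sorted xL.
move=> u v; rewrite inE => /predU1P[->|uprev] vL; first exact: hxL.
by apply: hlt; rewrite // inE vL orbT.
Qed.

Lemma primes_upto_sorted n : path.sorted ltn (primes_upto n).
Proof. by rewrite sorted_filter ?iota_ltn_sorted //; apply: ltn_trans. Qed.

Lemma all_prime_primes_upto n : all prime (primes_upto n).
Proof. exact: filter_all. Qed.

Lemma eliminator_small R q : {in R, forall r, 2 ^ 14 <= r} -> prime q ->
  71 < q < 1300 -> exists D, eliminator R q D.
Proof.
move=> hR qp /andP[q71 q1300].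
have [P eP chk] : exists2 P, P = primes_upto 1300 & all_coverable [::] P.
  by exists (primes_upto 1300); [reflexivity | vm_compute].
have [sP pP] : path.sorted ltn P /\ all prime P.
  by rewrite eP; split; [apply: primes_upto_sorted | apply: all_prime_primes_upto].
have qP : q \in P by rewrite eP mem_primes_upto qp ltnW.
have [//|c [uc hc cov]] := all_coverableP chk isT isT sP pP _ qP q71.
apply: (coverableP qp uc) cov => p /hc /andP[pp pq]; split => //.
apply/negP => /hR; have : p < 2 ^ 14 by rewrite (ltn_trans pq) // (ltn_trans q1300).
by rewrite ltnNge => /negPf->.
Qed.

(* An entry (x0, x1, T) handles the primes q in [x0, x1) with the help of the
   primes in [4T, x0). *)
Definition medium_table : seq (nat * nat * nat) :=
  [:: (1300, 1624, 39); (1624, 2480, 47); (2480, 5334, 76); (5334, 2 ^ 14, 119)].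

(** As [0 < n], the truncated subtraction is exact and the candidates number [n + 2 * T]. The bound
    on [x0] keeps them below every member of [R]. *)
Definition medium_ok (P : seq nat) (e : nat * nat * nat) : bool :=
  let: (x0, x1, T) := e in
  let n := size [seq p <- P | 4 * T <= p < x0] - 2 * T in
  [&& 0 < n, 0 < T, x0 <= 5334 & x1 <= 2 * iter T (grow n) 1].

Lemma eliminator_medium R q : {in R, forall r, 2 ^ 14 <= r} -> prime q ->
  1300 <= q < 2 ^ 14 -> exists D, eliminator R q D.
Proof.
move=> hR qp hq.
have [P eP chk] : exists2 P, P = primes_upto 5333 & all (medium_ok P) medium_table.
  by exists (primes_upto 5333); [reflexivity | vm_compute].
have [[[x0 x1] T] [/(allP chk) /and4P[n0 T0 x0le x1le] /= /andP[hx0 hx1]]] :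
    exists e, e \in medium_table /\ e.1.1 <= q < e.1.2.
  case/andP: hq => h1 h2.
  have [a1|a1] := ltnP q 1624; first by exists (1300, 1624, 39); rewrite h1 a1.
  have [a2|a2] := ltnP q 2480; first by exists (1624, 2480, 47); rewrite a1 a2.
  have [a3|a3] := ltnP q 5334; first by exists (2480, 5334, 76); rewrite a2 a3.
  by exists (5334, 2 ^ 14, 119); rewrite h2 a3.
set L := filter _ _ in n0 x1le.
apply: (@eliminator_exists R q _ T L qp n0 T0) => //.
- by rewrite filter_uniq ?eP ?primes_upto_uniq.
- move=> p; rewrite mem_filter eP mem_primes_upto => /and3P[/andP[h1 h2] pp _].
  split => //; first by rewrite h1 (leq_trans h2).
  apply/negP => /hR; rewrite leqNgt => /negP; apply.
  by rewrite (leq_trans h2) // (leq_trans x0le).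
- by move: n0; rewrite -/L; lia.
- exact: leq_trans hx1 x1le.
Qed.

End Small.

(** * Intervals of representable fractions *)

Definition window (E : nat -> Prop) (P : nat) (lo hi : rat) : Prop :=
  forall N : nat, lo <= N%:R / P%:R <= hi ->
  exists s : seq nat, [/\ uniq s, forall m, m \in s -> E m
    & \sum_(m <- s) recip m = N%:R / P%:R].

Lemma window_sub (E E' : nat -> Prop) P lo hi :
  (forall m, E m -> E' m) -> window E P lo hi -> window E' P lo hi.
Proof. by move=> h w N /w[s [us sE e]]; exists s; split => // m /sE /h. Qed.

(** A fraction above [hi] falls back into the old interval when [recip e] is subtracted, because the
    interval is at least that long. *)
Lemma window_add E P lo hi e : (0 < P)%N -> 0 <= lo -> (0 < e)%N -> (e %| P)%N -> ~ E e ->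
  window E P lo hi -> recip e <= hi - lo ->
  window (fun m => E m \/ m = e) P lo (hi + recip e).
Proof.
move=> P0 lo0 e0 eP nE w he N /andP[h1 h2].
have [h|h] := lerP (N%:R / P%:R) hi.
  by have [|s [us sE es]] := w N; [rewrite h1 | exists s; split => // m /sE; left].
have eq1 : recip e = (P %/ e)%N%:R / P%:R.
  have e0' : e%:R != 0 :> rat by rewrite pnatr_eq0 -lt0n.
  have P0' : P%:R != 0 :> rat by rewrite pnatr_eq0 -lt0n.
  rewrite /recip -{2}(divnK eP) natrM; field; rewrite e0' /=.
  by rewrite pnatr_eq0 -lt0n divn_gt0 // dvdn_leq.
have P0' : 0 < (P%:R : rat) by rewrite ltr0n.
have leN : (P %/ e <= N)%N.
  rewrite -(ler_nat rat) -(ler_pM2r (x := P%:R^-1)) ?invr_gt0 // -eq1; lra.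
have eq2 : (N - P %/ e)%N%:R / P%:R = N%:R / P%:R - recip e.
  by rewrite natrB // mulrBl -eq1.
have [|s [us sE es]] := w (N - P %/ e)%N; first by rewrite eq2; lra.
exists (e :: s); split.
- by rewrite /= us andbT; apply/negP => /sE.
- by move=> m; rewrite inE => /predU1P[->|/sE]; [right | left].
- by rewrite big_cons es eq2 addrC subrK.
Qed.

Lemma sum_mask_le (msk : bitseq) (D : seq nat) :
  \sum_(p <- mask msk D) recip p <= \sum_(p <- D) recip p.
Proof.
elim: D msk => [|p D IH] [|[] msk] //=; rewrite ?mask0s ?big_nil // ?big_cons.
- by rewrite addr_ge0 ?invr_ge0 // sumr_ge0 // => x _; rewrite invr_ge0.
- by rewrite lerD2l.
- by rewrite (le_trans (IH msk)) // lerDr invr_ge0.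
Qed.

(** Choose a subset [D'] of [D] whose inverses sum to [N / P] mod [q]. Then [M], the sum of the
    [P %/ p] over [D'], is congruent to [N], and subtracting the terms 1/(q p) leaves
    [((N - M) %/ q) / P]. The raised lower end ensures [M <= N] and that the difference is still at
    least [lo]. *)
Lemma window_elim E P lo hi q D : (0 < P)%N -> prime q -> ~~ (q %| P)%N ->
  0 <= lo -> uniq D -> {in D, forall p, (p %| P)%N} ->
  {in D, forall p, ~ E (q * p)%N} -> ssums (invs q D) = setT ->
  window E P lo hi ->
  window (fun m => E m \/ exists2 p, p \in D & m = (q * p)%N) (q * P)
    (lo + recip q * \sum_(p <- D) recip p) hi.
Proof.
move=> P0 qp qP lo0 uD DP DE DT w N /andP[h1 h2].
have q0 := prime_gt0 qp.
have Pu : P%:R != 0 :> 'F_q by rewrite -(dvdn_pcharf (pchar_Fp qp)).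
have := in_setT (N%:R / P%:R : 'F_q); rewrite -DT => /mem_ssums[msk].
rewrite /invs -map_mask big_map; set D' := mask msk D => eN.
have uD' : uniq D' by apply: mask_uniq.
have D'D p : p \in D' -> p \in D by apply: mem_mask.
pose M := (\sum_(p <- D') P %/ p)%N.
have p0 p : p \in D -> (0 < p)%N by move=> /DP /dvdn_gt0 ->.
have MN : N%:R = M%:R :> 'F_q.
  rewrite -[LHS](divfK Pu) eN /M natr_sum mulr_suml [LHS]big_seq [RHS]big_seq.
  apply: eq_bigr => p /D'D pD; have pu : p%:R != 0 :> 'F_q.
    rewrite -(dvdn_pcharf (pchar_Fp qp)); apply: contra qP => h.
    exact: dvdn_trans h (DP p pD).
  by apply: (mulfI pu); rewrite mulVKf // -natrM mulnC divnK ?DP.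
have MR : M%:R / (q * P)%:R = recip q * \sum_(p <- D') recip p.
  rewrite /M natr_sum mulr_suml mulr_sumr [LHS]big_seq [RHS]big_seq.
  apply: eq_bigr => p /D'D pD; rewrite /recip natrM -{2}(divnK (DP p pD)) natrM.
  have pn0 : p%:R != 0 :> rat by rewrite pnatr_eq0 -lt0n p0.
  have qn0 : q%:R != 0 :> rat by rewrite pnatr_eq0 -lt0n.
  field; rewrite pn0 qn0 /= pnatr_eq0 -lt0n divn_gt0 ?p0 //.
  by rewrite dvdn_leq ?DP.
have le_sub : \sum_(p <- D') recip p <= \sum_(p <- D) recip p. exact: sum_mask_le.
have q0' : 0 < (q%:R : rat) by rewrite ltr0n.
have P0' : 0 < (P%:R : rat) by rewrite ltr0n.
have rq0 : 0 < recip q by rewrite invr_gt0.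
have hM : M%:R / (q * P)%:R <= N%:R / (q * P)%:R :> rat.
  by rewrite MR (le_trans _ h1) // -[leLHS]add0r lerD // ler_pM2l.
have leMN : (M <= N)%N.
  by move: hM; rewrite ler_pM2r ?ler_nat // invr_gt0 ltr0n muln_gt0 q0.
have qNM : (q %| N - M)%N.
  by rewrite (dvdn_pcharf (pchar_Fp qp)) natrB // MN subrr.
have eq2 : ((N - M) %/ q)%N%:R / P%:R = N%:R / (q * P)%:R - M%:R / (q * P)%:R :> rat.
  rewrite -mulrBl -natrB // -{2}(divnK qNM) !natrM; field.
  by rewrite !gt_eqF.
have [|s [us sE es]] := w ((N - M) %/ q)%N.
  rewrite eq2 lerBrDr (le_trans _ h1) /=.
    by rewrite (le_trans _ h2) // lerBlDr lerDl divr_ge0.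
  by rewrite lerD2l MR ler_pM2l.
exists ([seq (q * p)%N | p <- D'] ++ s); split.
- rewrite cat_uniq us andbT map_inj_uniq ?uD' /=; last first.
    by move=> x y /eqP; rewrite eqn_pmul2l // => /eqP.
  by apply/hasPn => m ms; apply/negP => /mapP[p /D'D pD e]; apply: (DE p pD); rewrite -e; apply: sE.
- move=> m; rewrite mem_cat => /orP[/mapP[p /D'D pD ->]|/sE]; last by left.
  by right; exists p.
- rewrite big_cat /= es eq2 big_map MR mulr_sumr.
  rewrite (eq_bigr (fun p => recip q * recip p)) ?subrKC //.
    by move=> p _; rewrite /recip natrM invfM.
Qed.

(** * The first interval *)

Definition good (R : seq nat) (x m : nat) : Prop :=
  exists p p', [/\ prime p, prime p', (p < p' <= x)%N, p \notin R & p' \notin R]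
    /\ m = (p * p')%N.

Lemma window_of_range (E : nat -> Prop) (P a b : nat) : (0 < P)%N ->
  (forall N, (a <= N <= b)%N -> exists s : seq nat, [/\ uniq s, forall m, m \in s -> E m
    & \sum_(m <- s) recip m = N%:R / P%:R]) ->
  window E P (a%:R / P%:R) (b%:R / P%:R).
Proof.
by move=> P0 h N; rewrite !ler_pM2r ?invr_gt0 ?ltr0n // !ler_nat; apply: h.
Qed.

Definition subset_sums (ws : seq nat) : seq nat :=
  foldr (fun w S => S ++ [seq (w + n)%N | n <- S]) [:: 0%N] ws.

Lemma window_groups (P : nat) (gs : seq (nat * seq nat)) n :
  (forall g, g \in gs -> \sum_(m <- g.2) recip m = g.1%:R / P%:R) ->
  uniq (flatten [seq g.2 | g <- gs]) -> n \in subset_sums [seq g.1 | g <- gs] ->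
  exists s, [/\ uniq s, {subset s <= flatten [seq g.2 | g <- gs]}
    & \sum_(m <- s) recip m = n%:R / P%:R].
Proof.
elim: gs n => [|g gs IH] n hg /=.
  by rewrite inE => _ /eqP->; exists [::]; rewrite big_nil mul0r.
rewrite cat_uniq => /and3P[ug /hasPn hd us]; rewrite mem_cat => /orP[h|/mapP[n' h ->]].
  have [|s [us' sub e]] := IH n _ us h; first by move=> g' hg'; apply: hg; rewrite inE hg' orbT.
  by exists s; split => // m ms; rewrite mem_cat sub ?orbT.
have [|s [us' sub e]] := IH n' _ us h; first by move=> g' hg'; apply: hg; rewrite inE hg' orbT.
exists (g.2 ++ s); split.
- rewrite cat_uniq ug us' andbT; apply/hasPn => m /sub; exact: hd.
- by move=> m; rewrite !mem_cat => /orP[->//|/sub ->]; rewrite orbT.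
- by rewrite big_cat /= e hg ?mem_head // natrD mulrDl.
Qed.

(* In a row (w, s) the reciprocals of s sum to w/210.  The last four rows are (1/2+1/3+1/5)/31 = 7/210,
   (1/2+1/3+1/7)/41 = 5/210, (1/2+1/5+1/7)/59 = 3/210 and
   (1/3+1/5+1/7)/71 = 2/210. *)
Definition base_groups : seq (nat * seq nat) :=
  [:: (6, [:: 35]); (10, [:: 21]); (14, [:: 15]); (15, [:: 14]); (21, [:: 10]);
      (35, [:: 6]); (7, [:: 62; 93; 155]); (5, [:: 82; 123; 287]);
      (3, [:: 118; 295; 413]); (2, [:: 213; 355; 497])]%N.

Definition base_terms : seq nat := flatten [seq g.2 | g <- base_groups].

(** The weights total 118, so complements exchange [n] and [118 - n]. The range is maximal, as
    neither 4 nor 114 is a subset sum. *)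
Lemma window_210 : window (fun m => m \in base_terms) 210 (5%:R / 210%:R) (113%:R / 210%:R).
Proof.
have hw := @window_of_range (fun m => m \in base_terms) 210 5 113 isT.
apply: hw => N hN.
have chk : all (fun n => n \in subset_sums [seq g.1 | g <- base_groups]) (iota 5 109).
  by vm_compute.
have hg g : g \in base_groups -> \sum_(m <- g.2) recip m = g.1%:R / 210%:R.
  rewrite !inE => /or4P[/eqP|/eqP|/eqP|/or4P[/eqP|/eqP|/eqP|/or4P[/eqP|/eqP|/eqP|/eqP]]] ->;
  rewrite !big_cons big_nil /recip /=; lra.
have [|s [us sub e]] := @window_groups 210 base_groups N hg (erefl true).
  by apply: (allP chk); rewrite mem_iota.
by exists s; split => // m /sub.
Qed.

(* Found by search: the sum of all 1/(q p) has to stay below 108/210 - 1/72. *)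
Definition base_elims : seq (nat * seq nat) :=
  [:: (11, [:: 7; 5; 3; 2]); (13, [:: 11; 7; 5; 3; 2]); (17, [:: 13; 11; 7; 5; 3]);
      (19, [:: 17; 13; 11; 7; 3]); (23, [:: 19; 17; 13; 5; 3]);
      (29, [:: 23; 19; 17; 5; 3]); (31, [:: 29; 23; 19; 17; 13; 11]);
      (37, [:: 31; 29; 19; 17; 11; 5]); (41, [:: 37; 31; 29; 23; 19; 13]);
      (43, [:: 41; 29; 23; 19; 17; 11]); (47, [:: 41; 37; 29; 17; 13; 11]);
      (53, [:: 47; 43; 41; 37; 29; 11]); (59, [:: 53; 47; 43; 41; 37; 31; 23]);
      (61, [:: 59; 53; 47; 43; 41; 31; 29]); (67, [:: 61; 59; 53; 47; 41; 29; 23]);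
      (71, [:: 67; 61; 59; 53; 43; 41; 31])]%N.

Definition full_cover (q : nat) (D : seq nat) : bool :=
  all id (foldr (fun p => rot_or (inv_mod q p)) (true :: nseq q.-1 false) D).

Lemma full_coverP q D : prime q -> {in D, forall p, (0 < p < q)%N} ->
  full_cover q D -> ssums (invs q D) = setT.
Proof.
move=> qp hD hall.
have [sz hS] : encodes (foldr (fun p => rot_or (inv_mod q p)) (true :: nseq q.-1 false) D)
    (ssums (invs q D)).
  elim: D hD {hall} => [|p D IH] hD /=.
    exact: encodes_nil.
  apply: encodes_rot_or; rewrite ?hD ?mem_head //.
  by apply: IH => x xD; rewrite hD // inE xD orbT.
exact: encodes_full hall.
Qed.

(* [Q] lists the primes processed so far and [E] the denominators in use. *)
Fixpoint base_ok (x : nat) (Q E : seq nat) (C : seq (nat * seq nat)) : bool :=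
  if C is (q, D) :: C' then
    [&& prime q && (q <= x)%N, q \notin Q, uniq D,
        all (fun p => [&& p \in Q, (p < q)%N & (q * p)%N \notin E]) D, full_cover q D
      & base_ok x (q :: Q) ([seq (q * p)%N | p <- D] ++ E) C']
  else true.

(** Each entry is one use of [window_elim]: only the lower end moves, and no term is added to raise
    the upper end. *)
Lemma base_run R x (Q E : seq nat) C lo hi : base_ok x Q E C ->
  {in R, forall r, x < r}%N -> all prime Q -> all (fun p => p <= x)%N Q -> 0 <= lo ->
  (forall m, m \in E -> good R x m) ->
  window (fun m => m \in E) (\prod_(p <- Q) p) lo hi ->
  window (good R x) (\prod_(p <- catrev [seq c.1 | c <- C] Q) p)
    (lo + \sum_(c <- C) \sum_(p <- c.2) recip (c.1 * p)) hi.
Proof.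
move=> + hR; elim: C Q E lo => [|[q D] C IH] Q E lo /=.
  by move=> _ _ _ _ hE w; rewrite big_nil addr0; apply: window_sub w.
move=> /and5P[/andP[qp qx] qQ uD /allP hD /andP[cov hC]] pQ xQ lo0 hE w.
rewrite big_cons addrA /=; apply: IH hC _ _ _ _ _ => /=.
- by rewrite qp.
- by rewrite qx.
- by rewrite addr_ge0 // sumr_ge0 // => p _; rewrite invr_ge0.
- move=> m; rewrite mem_cat => /orP[/mapP[p /hD /and3P[pQ' pq _] ->]|/hE //].
  have notR y : (y <= x)%N -> y \notin R by move=> h; apply/negP => /hR; rewrite ltnNge h.
  exists p, q; split; last by rewrite mulnC.
  split; [exact: (allP pQ) | by [] | by rewrite pq | | exact: notR].
  by apply: notR; apply: (allP xQ).
rewrite big_cons; have -> : \sum_(p <- D) recip (q * p) = recip q * \sum_(p <- D) recip p.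
  by rewrite mulr_sumr; apply: eq_bigr => p _; rewrite /recip natrM invfM.
have P0 : (0 < \prod_(p <- Q) p)%N.
  by rewrite big_seq prodn_cond_gt0 // => p /(allP pQ) /prime_gt0.
have Dp p : p \in D -> (0 < p < q)%N.
  by move=> /hD /and3P[pQ' -> _]; rewrite prime_gt0 // (allP pQ).
have qP : ~~ (q %| \prod_(p <- Q) p)%N.
  rewrite Euclid_dvd_prod // big_has; apply/negP => /hasP[p pQ'] /=.
  rewrite dvdn_prime2 // ?(allP pQ) // => /eqP e.
  by rewrite e pQ' in qQ.
apply: window_sub (window_elim P0 qp qP lo0 uD _ _ (full_coverP qp Dp cov) w).
- move=> m [mE|[p pD ->]]; rewrite mem_cat; first by rewrite mE orbT.
  by rewrite map_f.
- by move=> p /hD /and3P[pQ' _ _]; rewrite (perm_big _ (perm_to_rem pQ')) /= big_cons dvdn_mulr.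
- by move=> p /hD /and3P[_ _ /negP].
Qed.

Definition base_primes : seq nat := catrev [seq c.1 | c <- base_elims] [:: 2; 3; 5; 7]%N.

(** Rounding up to multiples of [1 / K] turns a bound on a sum of reciprocals into integer
    arithmetic. *)
Lemma recip_le (K m : nat) : (0 < K)%N -> (0 < m)%N -> recip m <= (K %/ m).+1%:R / K%:R.
Proof.
move=> K0 m0; rewrite ler_pdivlMr ?ltr0n // mulrC /recip ler_pdivrMr ?ltr0n //.
by rewrite -natrM ler_nat ltnW // ltn_ceil.
Qed.

Lemma ler_ratio (a b c : nat) : (a <= b)%N -> a%:R / c%:R <= b%:R / c%:R :> rat.
Proof. by move=> ab; rewrite ler_wpM2r ?invr_ge0 ?ler0n // ler_nat. Qed.

Lemma sum_recip_le (K : nat) (s : seq nat) : (0 < K)%N -> all (leq 1) s ->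
  \sum_(m <- s) recip m <= (sumn [seq (K %/ m).+1 | m <- s])%:R / K%:R.
Proof.
move=> K0 /allP hs; rewrite sumnE big_map natr_sum mulr_suml big_seq [leRHS]big_seq.
by apply: ler_sum => m /hs; apply: recip_le.
Qed.

Lemma base_window R : {in R, forall r, 71 < r}%N ->
  exists lo, [/\ 0 <= lo, lo + 1 / 72 <= 113%:R / 210%:R
    & window (good R 71) (\prod_(p <- base_primes) p) lo (113%:R / 210%:R)].
Proof.
move=> hR.
have hE m : m \in base_terms -> good R 71 m.
  have chk : all (fun m => has (fun p => [&& prime p, prime (m %/ p), p < m %/ p <= 71
      & m == p * (m %/ p)]%N) [:: 2; 3; 5; 7]%N) base_terms by vm_compute.
  move=> /(allP chk) /hasP[p _ /and4P[pp pp' h /eqP e]]; exists p, (m %/ p)%N.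
  have notR y : (y <= 71)%N -> y \notin R by move=> hy; apply/negP => /hR; rewrite ltnNge hy.
  have [h1 h2] := andP h.
  split; last exact: e.
  split; [exact: pp | exact: pp' | exact: h | | exact: notR h2].
  by apply: notR; apply: leq_trans h2; apply: ltnW.
have ok : base_ok 71 [:: 2; 3; 5; 7]%N base_terms base_elims by vm_compute.
have w210 : window (fun m => m \in base_terms) (\prod_(p <- [:: 2; 3; 5; 7]%N) p)
    (5%:R / 210%:R) (113%:R / 210%:R).
  by rewrite !big_cons big_nil; apply: window_210.
have := base_run ok hR isT isT _ hE w210.
set d := \sum_(c <- base_elims) _ => w; exists (5%:R / 210%:R + d); split.
- apply: addr_ge0; first exact: divr_ge0 (ler0n _ _) (ler0n _ _).
  by apply: sumr_ge0 => c _; apply: sumr_ge0 => p _; rewrite invr_ge0 ler0n.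
- have ed : d = \sum_(m <- flatten [seq [seq (c.1 * p)%N | p <- c.2] | c <- base_elims]) recip m.
    by rewrite big_flatten big_map; apply: eq_bigr => c _; rewrite big_map.
  (* A bound of 1000/2000 suffices, because 5/210 + 1/2 + 1/72 is below 113/210. *)
  have [S eS S1000] : exists2 S, S = sumn [seq (2000 %/ m).+1
      | m <- flatten [seq [seq (c.1 * p)%N | p <- c.2] | c <- base_elims]] & (S <= 1000)%N.
    by eexists; [reflexivity | vm_compute].
  have pos : all (leq 1) [seq (c.1 * p)%N | c <- base_elims, p <- c.2] by vm_compute.
  have := @sum_recip_le 2000 _ isT pos; rewrite -ed -eS => hd.
  have hS : S%:R / 2000%:R <= 1000%:R / 2000%:R :> rat.
    exact: ler_ratio S1000.
  lra.
- by apply: w; exact: divr_ge0 (ler0n _ _) (ler0n _ _).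
Qed.

(** * Divergence of the sum of prime reciprocals *)

Section Divergence.

(** Each block of [j] from [2 ^ M + 1] to [2 ^ M.+1] contributes at least 1/2. *)
Lemma harmonic_unbounded M : exists N, M%:R / 2%:R <= \sum_(1 <= j < N) recip j.
Proof.
suff h : M%:R / 2%:R <= \sum_(1 <= j < (2 ^ M).+1) recip j by exists (2 ^ M).+1.
elim: M => [|M IH]; first by rewrite mul0r sumr_ge0 // => j _; rewrite invr_ge0 ler0n.
rewrite (@big_cat_nat _ _ _ (2 ^ M).+1) //=; last by rewrite ltnS leq_exp2l.
rewrite -natr1 mulrDl lerD //.
apply: (@le_trans _ _ (\sum_((2 ^ M).+1 <= j < (2 ^ M.+1).+1) recip (2 ^ M.+1))).
  rewrite sumr_const_nat subSS expnS mul2n -addnn addnK /recip natrD -[leRHS]mulr_natl.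
  have : 0 < ((2 ^ M)%N%:R : rat) by rewrite ltr0n expn_gt0.
  move: ((2 ^ M)%N%:R : rat) => u u0; rewrite le_eqVlt; apply/orP; left; apply/eqP; field.
  by apply: lt0r_neq0; lra.
rewrite [leLHS]big_nat [leRHS]big_nat; apply: ler_sum => j /andP[h1 h2].
by rewrite /recip lef_pV2 ?ler_nat // posrE ltr0n ?expn_gt0 // (leq_trans _ h1).
Qed.

Lemma recip_half k : recip (2 ^ k) = recip (2 ^ k.+1) + recip (2 ^ k.+1).
Proof.
rewrite /recip expnS natrM; have : 0 < ((2 ^ k)%N%:R : rat) by rewrite ltr0n expn_gt0.
by move=> h; field; rewrite gt_eqF.
Qed.

(** A geometric series starting at the first power of 2 that is at least [q]; the subtracted tail
    makes the induction go through. *)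
Lemma dyadic_le N q : (0 < q)%N ->
  \sum_(1 <= j < N.+1 | (q <= 2 ^ j)%N) recip (2 ^ j.+1) <=
  if (q <= 2 ^ N)%N then recip q - recip (2 ^ N.+1) else 0.
Proof.
move=> q0; elim: N => [|N IH].
  rewrite big_geq //; case: ifP => // hq; rewrite subr_ge0 /recip.
  by rewrite lef_pV2 ?ler_nat ?posrE ?ltr0n // (leq_trans hq).
rewrite big_mkcond big_nat_recr //= -big_mkcond /=.
move: IH; case: (leqP q (2 ^ N)) => hq IH.
  rewrite (leq_trans hq) ?leq_exp2l //; have := recip_half N.+1; lra.
case: ifP => hq'; last by lra.
have : recip (2 ^ N.+1) <= recip q.
  by rewrite /recip lef_pV2 ?ler_nat ?posrE ?ltr0n ?expn_gt0.
have := recip_half N.+1; lra.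
Qed.

Lemma geometric_le N : \sum_(1 <= j < N) recip (2 ^ j) <= 1.
Proof.
case: N => [|N]; first by rewrite big_geq.
suff : \sum_(1 <= j < N.+1) recip (2 ^ j) <= 1 - recip (2 ^ N).
  by move/le_trans; apply; rewrite lerBlDr lerDl invr_ge0 ler0n.
elim: N => [|N IH]; first by rewrite big_geq // /recip invr1 subrr.
by rewrite big_nat_recr //=; have := recip_half N; lra.
Qed.

(* Summing 1/q >= sum of 2^-(j+1) over the j with q <= 2^j and exchanging the
   sums leaves the prime counts at powers of 2, which Chebyshev bounds below. *)
Lemma recip_primes_unbounded (R : seq nat) (B : rat) :
  exists x, B <= \sum_(q <- primes_upto x | (71 < q)%N && (q \notin R)) recip q.
Proof.
(* 72 for the numbers up to 71, [size R] for the primes in [R], and 1 for the successor in the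
   exponent of [chebyshev]. *)
pose C := (73 + size R)%N.
pose Q x := [seq q <- primes_upto x | (71 < q)%N && (q \notin R)].
have sizeQ x : (size (primes_upto x) < size (Q x) + C)%N.
  have : (size (primes_upto x) <= size (Q x ++ iota 0 72 ++ R))%N.
    apply: uniq_leq_size; first exact: primes_upto_uniq.
    move=> p px; rewrite !mem_cat mem_filter px andbT mem_iota /= ltnS.
    by case: (ltnP 71 p) => h; rewrite ?h //=; case: (p \in R); rewrite ?orbT.
  by rewrite !size_cat size_iota /C; lia.
(* At [2 * h = 2 ^ j], Chebyshev's bound says that [2 ^ j] is at most [j] times one more than the
   number of primes up to [2 ^ j]. *)
have cheb j : (0 < j)%N ->
    recip j - C%:R * recip (2 ^ j) <= (size (Q (2 ^ j)%N))%:R * recip (2 ^ j).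
  move=> j0; rewrite lerBlDr -mulrDl -natrD.
  have h0 : (0 < 2 ^ j.-1)%N by rewrite expn_gt0.
  have := chebyshev h0; rewrite -expnS prednK // -expnM leq_exp2l // => h.
  rewrite /recip ler_pdivlMr ?ltr0n ?expn_gt0 // mulrC ler_pdivrMr ?ltr0n //.
  rewrite -natrM ler_nat (leq_trans h) // mulnC leq_mul2r.
  by rewrite sizeQ orbT.
(* The exchange of sums costs a factor 2 and the excluded primes cost at most [C]. *)
have [M hM] : exists M : nat, 2 * B + C%:R <= M%:R / 2%:R.
  exists (2 * Num.bound `|2 * B + C%:R : rat|)%N.
  rewrite natrM [leRHS]mulrC mulKf ?pnatr_eq0 //.
  by apply: le_trans (ler_norm _) (ltW (archi_boundP _)).
have [N hN] := harmonic_unbounded M.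
exists (2 ^ N)%N; rewrite -big_filter -/(Q _).
have qge0 q : 0 <= recip q by rewrite invr_ge0 ler0n.
have exch : \sum_(1 <= j < N) (size (Q (2 ^ j)%N))%:R * recip (2 ^ j.+1) <=
    \sum_(q <- Q (2 ^ N)%N) recip q.
  apply: (@le_trans _ _ (\sum_(q <- Q (2 ^ N)%N)
      \sum_(1 <= j < N | (q <= 2 ^ j)%N) recip (2 ^ j.+1))).
    under [leRHS]eq_bigr => q _ do rewrite big_mkcond.
    rewrite exchange_big /= [leLHS]big_nat [leRHS]big_nat; apply: ler_sum => j /andP[_ jN].
    rewrite -big_mkcond big_const_seq iter_addr_0 -[leRHS]mulr_natl.
    rewrite ler_wpM2r // ler_nat -size_filter.
    apply: uniq_leq_size; first by rewrite filter_uniq ?primes_upto_uniq.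
    move=> p; rewrite /Q !mem_filter !mem_iota /= !add0n !ltnS => /and3P[-> -> h] /=.
    by rewrite h (leq_trans h) // leq_exp2l // ltnW.
  rewrite [leLHS]big_seq [leRHS]big_seq; apply: ler_sum => q; rewrite mem_filter mem_primes_upto.
  move=> /and3P[_ /prime_gt0 q0 _]; case: N {hN} => [|N]; first by rewrite big_geq.
  by apply: le_trans (dyadic_le N q0) _; case: ifP => // _; rewrite lerBlDr lerDl.
apply: le_trans exch.
have -> : \sum_(1 <= j < N) (size (Q (2 ^ j)%N))%:R * recip (2 ^ j.+1) =
    (\sum_(1 <= j < N) (size (Q (2 ^ j)%N))%:R * recip (2 ^ j)) / 2.
  by rewrite mulr_suml; apply: eq_bigr => j _; have := recip_half j; nra.
have : \sum_(1 <= j < N) recip j - C%:R * \sum_(1 <= j < N) recip (2 ^ j) <=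
    \sum_(1 <= j < N) (size (Q (2 ^ j)%N))%:R * recip (2 ^ j).
  rewrite mulr_sumr -sumrB [leLHS]big_nat [leRHS]big_nat; apply: ler_sum => j /andP[j0 _].
  exact: cheb.
have : C%:R * \sum_(1 <= j < N) recip (2 ^ j) <= C%:R.
  by rewrite -[leRHS]mulr1 ler_wpM2l ?ler0n // geometric_le.
lra.
Qed.

End Divergence.

(** * Reaching large rationals *)

Section Induction.

Variable R : seq nat.
Hypothesis uniq_R : uniq R.
Hypothesis R_large : {in R, forall r, 2 ^ (size R + 14) <= r}%N.

Definition primorial (x : nat) : nat := \prod_(p <- primes_upto x | p \notin R) p.

Definition base_top : rat := locked (113%:R / 210%:R).

Lemma base_top_ge0 : 0 <= base_top.
Proof. by rewrite /base_top -lock; exact: divr_ge0 (ler0n _ _) (ler0n _ _). Qed.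

Lemma base_top_lt1 : base_top < 1.
Proof. by rewrite /base_top -lock ltr_pdivrMr ?mul1r ?ltr_nat // ltr0n. Qed.

(** The upper end of the interval after all primes up to [x]: those up to 71 leave it fixed, and
    each later one outside [R] raises it by 1/(2q). *)
Definition top (x : nat) : rat :=
  base_top + \sum_(q <- primes_upto x | (71 < q)%N && (q \notin R)) recip (2 * q).

Lemma R_gt r : r \in R -> (2 ^ 14 <= r)%N.
Proof. by move/R_large; apply: leq_trans; rewrite leq_exp2l // leq_addl. Qed.

Lemma eliminator_any q : prime q -> (71 < q)%N -> exists D, eliminator R q D.
Proof.
move=> qp q71; have [h|h] := ltnP q 1300.
  by apply: eliminator_small => //; [exact: R_gt | rewrite q71].
have [h'|h'] := ltnP q (2 ^ 14); last exact: eliminator_large.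
by apply: eliminator_medium => //; [exact: R_gt | rewrite h].
Qed.

Lemma primes_uptoS x : primes_upto x.+1 = primes_upto x ++ [seq p <- [:: x.+1] | prime p].
Proof. by rewrite /primes_upto -addn1 iotaD filter_cat add0n. Qed.

Lemma primorial_gt0 x : (0 < primorial x)%N.
Proof.
rewrite /primorial big_seq_cond prodn_cond_gt0 // => p.
by rewrite mem_primes_upto => /andP[/andP[/prime_gt0]].
Qed.

Lemma dvdn_primorial x p : prime p -> (p <= x)%N -> p \notin R -> (p %| primorial x)%N.
Proof.
move=> pp px pR; rewrite /primorial -big_filter.
have pin : p \in [seq q <- primes_upto x | q \notin R].
  by rewrite mem_filter pR mem_primes_upto pp.
by rewrite (perm_big _ (perm_to_rem pin)) /= big_cons dvdn_mulr.
Qed.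

Lemma ndvdn_primorial x q : prime q -> (x < q)%N -> ~~ (q %| primorial x)%N.
Proof.
move=> qp xq; rewrite /primorial Euclid_dvd_prod // big_has_cond; apply/hasPn => p.
rewrite mem_primes_upto => /andP[pp px]; rewrite negb_and orbC dvdn_prime2 //.
by rewrite neq_ltn (leq_ltn_trans px xq) orbT.
Qed.

Lemma good_widen x y m : (x <= y)%N -> good R x m -> good R y m.
Proof.
move=> xy [p [p' [[pp pp' /andP[h1 h2] pR pR'] e]]]; exists p, p'; split => //.
by split => //; rewrite h1 (leq_trans h2).
Qed.

Lemma good_ndvd x m q : prime q -> (x < q)%N -> good R x m -> ~~ (q %| m)%N.
Proof.
move=> qp xq [p [p' [[pp pp' /andP[h1 h2] _ _] ->]]].
by rewrite Euclid_dvdM // !dvdn_prime2 // negb_or !neq_ltn; apply/andP; split; lia.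
Qed.

(** The lower end rises by at most 1/(2q) and the upper end by exactly that, so the length stays at
    least 1/72. As [q] is at least 72, the length is at least 1/q, which leaves room for the term
    1/(2q) after the elimination. *)
Lemma window_step x q lo t : (71 <= x)%N -> x.+1 = q -> prime q -> q \notin R ->
  0 <= lo -> lo + 1 / 72 <= t -> window (good R x) (primorial x) lo t ->
  exists lo', [/\ 0 <= lo', lo' + 1 / 72 <= t + recip (2 * q)
    & window (good R q) (q * primorial x) lo' (t + recip (2 * q))].
Proof.
move=> x71 xq qp qR lo0 hlo w.
have ltxq : (x < q)%N by rewrite xq.
have q71 : (71 < q)%N := leq_ltn_trans x71 ltxq.
have [D [uD hD sD cD]] := eliminator_any qp q71.
have q0 := prime_gt0 qp.
pose r : rat := recip q * \sum_(p <- D) recip p.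
have rq0 : 0 < recip q by rewrite invr_gt0 ltr0n.
have rq72 : recip q <= 1 / 72.
  by rewrite mul1r; apply: (@recip_anti 72 q isT q71).
have S0 : 0 <= \sum_(p <- D) recip p by rewrite sumr_ge0 // => p _; rewrite invr_ge0 ler0n.
have r0 : 0 <= r by rewrite mulr_ge0 // ltW.
have e2q : recip (2 * q) = recip q / 2 by rewrite /recip natrM invfM mulrC.
have rle : r <= recip (2 * q) by rewrite e2q ler_pM2l // -[2^-1]mul1r.
have DP : {in D, forall p, (p %| primorial x)%N}.
  by move=> p /hD[pp /andP[_ pq] pR]; apply: dvdn_primorial => //; rewrite -ltnS xq.
have DE : {in D, forall p, ~ good R x (q * p)%N}.
  by move=> p _ /(good_ndvd qp ltxq) /negP; apply; apply: dvdn_mulr.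
have := window_elim (primorial_gt0 x) qp (ndvdn_primorial qp ltxq) lo0 uD DP DE cD w.
rewrite -/r => w1.
have notR2 : 2%N \notin R by apply/negP => /R_gt; rewrite leqNgt => /negP; apply.
have d2 : (2 * q %| q * primorial x)%N.
  rewrite mulnC dvdn_pmul2l //; apply: dvdn_primorial => //.
  exact: (leq_trans _ x71).
exists (lo + r); split; [by rewrite addr_ge0 | lra | ].
have P0 : (0 < q * primorial x)%N by rewrite muln_gt0 q0 primorial_gt0.
have E2 : ~ (good R x (2 * q) \/ exists2 p, p \in D & (2 * q)%N = (q * p)%N).
  case=> [/(good_ndvd qp ltxq)|[p /hD[_ /andP[p2 _] _]]]; first by rewrite dvdn_mull.
  by rewrite mulnC => /eqP; rewrite eqn_pmul2l // => /eqP e2; rewrite -e2 in p2.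
have q20 : (0 < 2 * q)%N by rewrite muln_gt0.
have hi2q : recip (2 * q) <= t - (lo + r) by lra.
apply: window_sub (window_add P0 (addr_ge0 lo0 r0) q20 d2 E2 w1 hi2q).
have pair p : prime p -> (p < q)%N -> p \notin R -> good R q (q * p)%N.
  move=> pp pq pR; exists p, q; split; last by rewrite mulnC.
  by split; rewrite ?pq ?leqnn.
move=> m [[|[p /hD[pp /andP[_ pq] pR] ->]]|->].
- by apply: good_widen; apply: ltnW.
- exact: pair.
by rewrite mulnC; apply: pair => //; apply: leq_trans q71.
Qed.

Lemma top_small x : (x <= 71)%N -> top x = base_top.
Proof.
move=> x71; rewrite /top big_seq_cond big1 ?addr0 // => q.
rewrite mem_primes_upto => /andP[/andP[_ h1] /andP[h2 _]].
by rewrite ltnNge (leq_trans h1 x71) in h2.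
Qed.

Lemma window_at x : (71 <= x)%N ->
  exists lo, [/\ 0 <= lo, lo + 1 / 72 <= top x & window (good R x) (primorial x) lo (top x)].
Proof.
move=> hx; rewrite -(subnK hx); elim: (x - 71)%N => [|y].
  rewrite add0n; have [|lo [lo0 hlo w]] := @base_window R.
    by move=> r /R_gt; apply: leq_trans.
  rewrite [113%:R / 210%:R]lock -/base_top -(top_small (leqnn 71)) in hlo w.
  exists lo; split => //.
  (* All members of [R] exceed 71, so no prime up to 71 is left out. *)
  have -> : primorial 71 = \prod_(p <- base_primes) p.
    rewrite /primorial -big_filter; apply: perm_big.
    rewrite (_ : [seq p <- _ | _] = primes_upto 71); first by [].
    apply/all_filterP/allP => p; rewrite mem_primes_upto => /andP[_ h].
    by apply/negP => /R_gt; rewrite leqNgt (leq_ltn_trans h).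
  exact: w.
rewrite addSn; set z := (y + 71)%N => -[lo [lo0 hlo w]].
have z71 : (71 <= z)%N by rewrite leq_addl.
rewrite /primorial /top primes_uptoS !big_cat addrA /= -/(primorial z) -/(top z).
have [pz|npz] := boolP (prime z.+1); last first.
  rewrite !big_nil addr0 muln1; exists lo; split => //.
  by apply: window_sub w => m; apply: good_widen.
have [zR|zR] := boolP (z.+1 \in R).
  rewrite !big_cons !big_nil zR andbF addr0 /= muln1; exists lo; split => //.
  by apply: window_sub w => m; apply: good_widen.
rewrite !big_cons !big_nil zR (_ : (71 < z.+1)%N) //= muln1 addr0 (mulnC (primorial z)).
exact: (@window_step z z.+1 lo (top z) z71 erefl pz zR lo0 hlo w).
Qed.

Lemma topS x : top x.+1 =
  top x + (if prime x.+1 && ((71 < x.+1)%N && (x.+1 \notin R)) then recip (2 * x.+1) else 0).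
Proof.
rewrite /top primes_uptoS big_cat addrA /=; congr (_ + _).
by case: (prime _); rewrite ?big_cons big_nil //= addr0.
Qed.

(** A crude bound, by which a large target forces a large [x]. *)
Lemma top_le x : top x <= x%:R + 1.
Proof.
elim: x => [|x IH].
  by rewrite (@top_small 0 isT) add0r ltW // base_top_lt1.
rewrite topS -natr1; apply: lerD IH _; case: ifP => // _.
have h : (1 <= 2 * x.+1)%N by rewrite muln_gt0.
by apply: le_trans (recip_anti (ltn0Sn 0) h) _; rewrite /recip invr1.
Qed.

Lemma top_step_le x : (71 <= x)%N -> top x.+1 <= top x + 1 / 72.
Proof.
move=> x71; rewrite topS lerD2l; case: ifP => _; last by rewrite divr_ge0.
rewrite mul1r; apply: (@recip_anti 72 (2 * x.+1) isT).
rewrite mul2n -addnn; apply: leq_trans (leq_addr _ _); exact: x71.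
Qed.

(* The first x with X <= top x: there the lower end of the window is below
   top (x - 1) < X. *)
Lemma window_reach (X : rat) : 1 <= X ->
  exists x, X <= x%:R + 1 /\ exists lo, lo <= X <= top x /\
    window (good R x) (primorial x) lo (top x).
Proof.
move=> X1.
have [x0 hx0] : exists x, X <= top x.
  have [x hx] := recip_primes_unbounded R (2 * X).
  exists x; rewrite /top -[leLHS]add0r lerD //.
    exact: base_top_ge0.
  rewrite -(ler_pM2l (x := 2)) // (le_trans hx) // mulr_sumr; apply: ler_sum => q _.
  by rewrite /recip natrM invfM mulVKf.
pose P x := X <= top x.
have [x Px xmin] := ex_minnP (ex_intro P x0 hx0).
have x71 : (71 < x)%N.
  rewrite ltnNge; apply/negP => hx; move: base_top_lt1; rewrite ltNge => /negP; apply.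
  by rewrite -(top_small hx) (le_trans X1).
exists x; split; first exact: le_trans Px (top_le x).
have [lo [_ hlo w]] := window_at (ltnW x71).
exists lo; split => //; rewrite [X <= _]Px andbT.
case: x x71 Px xmin hlo {w} => // z z71 _ xmin hlo.
have hz : top z < X by rewrite ltNge; apply/negP => /xmin; rewrite ltnn.
apply: le_trans (ltW hz); rewrite -(lerD2r (1 / 72)).
exact: le_trans hlo (top_step_le z71).
Qed.

End Induction.

(** * Squarefree products of primes and the conclusion *)

Lemma dvdn_prod_primes (l : seq nat) p : all prime l -> prime p ->
  (p %| \prod_(r <- l) r)%N = (p \in l).
Proof.
move=> /allP hl pp; rewrite Euclid_dvd_prod // big_has; apply/hasP/idP => [[r rl]|pl].
  by rewrite /= dvdn_prime2 ?(hl r rl) // => /eqP->.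
by exists p; [exact: pl | rewrite /= dvdnn].
Qed.

Lemma prod_primes_gt0 (l : seq nat) : all prime l -> (0 < \prod_(r <- l) r)%N.
Proof. by move=> /allP hl; rewrite big_seq prodn_cond_gt0 // => p /hl /prime_gt0. Qed.

(** If the square of a prime [p] divided the product, [p] would divide the product of the other
    members of [l]. *)
Lemma squarefree_prod (l : seq nat) : uniq l -> all prime l -> squarefree (\prod_(r <- l) r).
Proof.
move=> ul pl d hd; apply/eqP; apply: contraT => d1.
have d0 : (0 < d)%N.
  by case: d hd {d1} => //; rewrite dvd0n eqn0Ngt prod_primes_gt0.
have pp : prime (pdiv d) by rewrite pdiv_prime // ltn_neqAle eq_sym d1.
set p := pdiv d in pp.
have : (p * p %| \prod_(r <- l) r)%N.
  by apply: dvdn_trans hd; apply: dvdn_mul; apply: pdiv_dvd.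
move=> h; have pinl : p \in l by rewrite -dvdn_prod_primes // (dvdn_trans _ h) // dvdn_mulr.
move: h; rewrite (perm_big _ (perm_to_rem pinl)) /= big_cons dvdn_pmul2l ?prime_gt0 //.
rewrite dvdn_prod_primes //; last by apply/allP => r /mem_rem; apply: (allP pl).
by rewrite mem_rem_uniq // inE eqxx.
Qed.

Lemma size_primes_prod (l : seq nat) : uniq l -> all prime l ->
  size (primes (\prod_(r <- l) r)) = size l.
Proof.
move=> ul pl; apply/perm_size/uniq_perm => //; first exact: primes_uniq.
move=> p; rewrite mem_primes prod_primes_gt0 //=.
have [pp|np] := boolP (prime p); first by rewrite dvdn_prod_primes.
by apply/esym/negP => /(allP pl); apply/negP.
Qed.

(** Divisibility is checked on the [p]-parts of [b], each of which is just [p]. *)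
Lemma squarefree_dvd b P : squarefree b ->
  (forall p, prime p -> (p %| b)%N -> (p %| P)%N) -> (b %| P)%N.
Proof.
move=> sb h; have b0 : (0 < b)%N by case: b sb {h} => // /(_ 0%N (dvdn0 _)).
apply/dvdn_partP => // p; rewrite mem_primes => /and3P[pp _ pb].
rewrite p_part (_ : logn p b = 1%N) ?expn1 ?h //.
apply/eqP; rewrite eqn_leq logn_gt0 mem_primes pp b0 pb andbT.
rewrite leqNgt -pfactor_dvdn // ?andbT; apply/negP => h2; have e : p = 1%N := sb p h2.
by rewrite e in pp.
Qed.

Lemma exists_primes_above K M :
  exists l, [/\ uniq l, size l = K, all prime l & {in l, forall p, M < p}%N].
Proof.
elim: K M => [|K IH] M; first by exists [::].
have [p Mp pp] := prime_above M; have [l [ul sl pl hl]] := IH p.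
exists (p :: l); split => /=; rewrite ?ul ?sl ?pp ?andbT //.
- by apply/negP => /hl; rewrite ltnn.
- by move=> r; rewrite inE => /predU1P[->//|/hl]; apply: ltn_trans.
Qed.

Unset Implicit Arguments.

Theorem corollary8p6 (k a b : nat) (hk : (3 <= k)%N) (ha : (0 < a)%N)
    (hb : squarefree b) :
  exists s : seq nat,
    [/\ uniq s,
        forall m : nat, m \in s -> squarefree m /\ size (primes m) = k
      & a%:R / b%:R = \sum_(m <- s) (1 / m%:R) :> rat].
Proof.
have b0 : (0 < b)%N by case: b hb => // /(_ 0%N (dvdn0 _)).
have k2 : (k - 2).+2 = k by lia.
(* The power of 2 is what the eliminators require of [R]; the summand [b * b.+1] makes [X] exceed
   [b] and keeps the prime factors of [b] out of [R]. *)
have [R [uR sR pR hR]] := exists_primes_above (k - 2) (2 ^ (k - 2 + 14) + b * b.+1).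
have R_large : {in R, forall r, 2 ^ (size R + 14) <= r}%N.
  by move=> r /hR h; rewrite sR; apply: leq_trans (ltnW h); apply: leq_addr.
have R_b : {in R, forall r, b * b.+1 < r}%N.
  by move=> r /hR; apply: leq_ltn_trans; apply: leq_addl.
pose r := (\prod_(p <- R) p)%N.
have r0 : (0 < r)%N by apply: prod_primes_gt0.
(* Here [3 <= k] enters: [R] is nonempty, so the product is at least one of its members. *)
have rb : (b * b.+1 <= r)%N.
  case: R {hR R_large} sR pR R_b @r r0 {uR} => [|p R].
    by move=> /= e; rewrite -e in k2; rewrite -k2 in hk.
  move=> _ /= /andP[_ pR] /(_ p (mem_head _ _)) h _; rewrite big_cons.
  by apply: leq_trans (ltnW h) (leq_pmulr _ (prod_primes_gt0 pR)).
have [bR rR] : (b%:R != 0 :> rat) /\ (r%:R != 0 :> rat) by rewrite !pnatr_eq0 -!lt0n.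
pose X : rat := (a * r)%:R / b%:R.
(* With [X <= x + 1] this yields [b <= x], so every prime factor of [b] occurs in the primorial. *)
have bX : (b.+1)%:R <= X.
  rewrite /X ler_pdivlMr ?ltr0n // -natrM ler_nat mulnC (leq_trans rb) //.
  exact: leq_pmull.
have X1 : 1 <= X by apply: le_trans bX; rewrite ler1n.
have [x [Xx [lo [/andP[loX Xhi] w]]]] := window_reach uR R_large X1.
have bx : (b <= x)%N.
  by move: (le_trans bX Xx); rewrite natr1 ler_nat ltnS.
have bP : (b %| primorial R x)%N.
  apply: squarefree_dvd => // p pp pb; apply: dvdn_primorial => //.
    exact: leq_trans (dvdn_leq b0 pb) bx.
  apply/negP => /R_b; rewrite ltnNge (leq_trans (dvdn_leq b0 pb)) //.
  exact: leq_pmulr.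
pose N := (a * r * (primorial R x %/ b))%N.
have NX : N%:R / (primorial R x)%:R = X.
  have d0 : ((primorial R x %/ b)%N%:R != 0 :> rat).
    by rewrite pnatr_eq0 -lt0n divn_gt0 // dvdn_leq ?primorial_gt0.
  by rewrite /N /X -{2}(divnK bP) ![(_ * _)%N%:R]natrM; field; rewrite d0 bR.
have [|s [us sE es]] := w N; first by rewrite NX loX.
(* Multiplying by [r] brings in the [k - 2] primes of [R], all different from the two primes of
   [m]. *)
exists [seq (m * r)%N | m <- s]; split.
- by rewrite map_inj_uniq // => m n /eqP; rewrite eqn_pmul2r // => /eqP.
- move=> _ /mapP[m /sE[p [p' [[pp pp' /andP[lt_pp' _] pnR p'nR] ->]]] ->].
  have -> : (p * p' * r = \prod_(q <- p :: p' :: R) q)%N by rewrite !big_cons mulnA.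
  have u : uniq (p :: p' :: R).
    by rewrite /= inE negb_or pnR p'nR uR !andbT neq_ltn lt_pp'.
  have al : all prime (p :: p' :: R) by rewrite /= pp pp'.
  by split; [apply: squarefree_prod | rewrite size_primes_prod //= sR k2].
- rewrite big_map (eq_bigr (fun m => recip m * r%:R^-1)); last first.
    by move=> m _; rewrite /recip natrM invfM mul1r.
  by rewrite -mulr_suml es NX /X natrM; field; rewrite rR.
Qed.
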